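(* Let $p,q>0$ be real numbers and consider the difference equation $$x_{n+1}=\frac{p\,x_{n-1}+q}{x_nx_{n-1}},\qquad n=0,1,2,\ldots,$$ with initial values $x_{-1},x_0\in I=(0,+\infty)$. Its unique positive equilibrium point $\overline{x}=\phi$ is globally asymptotically stable.
   Context: An equilibrium point is $\overline{x}\in I$ with $\overline{x}=f(\overline{x},\overline{x})$, where $f:I^2\to I$, $f(x,y)=\frac{py+q}{xy}$. The equation is the rewriting, with $p=\alpha/\gamma$ and $q=\beta/\gamma$, of $x_{n+1}=\frac{\alpha x_{n-1}+\beta}{\gamma x_nx_{n-1}}$ with $\alpha,\beta,\gamma>0$. The number $\phi$ is given by $\phi=\dfrac{R^2+12p}{6R}$ with $R=\sqrt[3]{108q+12\sqrt{-12p^3+81q^2}}$ (principal square and cube roots in $\mathbb{C}$ if $-12p^3+81q^2<0$); it is the unique positive equilibrium of the equation. The equilibrium $\overline{x}$ is locally stable if for every $\varepsilon>0$ there exists $\delta>0$ such that for all $x_{-1},x_0\in I$ with $|x_{-1}-\overline{x}|+|x_0-\overline{x}|<\delta$ one has $|x_n-\overline{x}|<\varepsilon$ for all $n\ge -1$. It is a global attractor if for all $x_{-1},x_0\in I$ one has $\lim_{n\to\infty}x_n=\overline{x}$. It is globally asymptotically stable if it is locally stable and a global attractor. *)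

(* Defs.v *)
From Stdlib Require Export Reals.
From Coquelicot Require Export Coquelicot.
Open Scope R_scope.

(* Principal argument, in (-PI, PI].  Its value at 0 is irrelevant. *)
Definition Carg (z : C) : R :=
  if Rle_dec 0 (Im z) then acos (Re z / Cmod z) else - acos (Re z / Cmod z).

(* Principal n-th root (n >= 1): |z|^(1/n) * exp (i * arg z / n).
   Zero is treated apart because Stdlib's [Rpower 0 y] is 1. *)
Definition Croot (n : nat) (z : C) : C :=
  if Req_dec_T (Cmod z) 0 then RtoC 0
  else (RtoC (Rpower (Cmod z) (/ INR n)) *
        (cos (Carg z / INR n), sin (Carg z / INR n)))%C.

Definition phi (p q : R) : C :=
  let r := Croot 3 (RtoC (108 * q) +
                    RtoC 12 * Croot 2 (RtoC (- 12 * p ^ 3 + 81 * q ^ 2)))%C in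
  ((r * r + RtoC (12 * p)) / (RtoC 6 * r))%C.

Definition fmap (p q x y : R) : R := (p * y + q) / (x * y).

(* The index is shifted by one: [x n] stands for x_{n-1}, so that [x 0] and
   [x 1] are the initial values x_{-1} and x_0. *)
Definition is_solution (g : R -> R -> R) (x : nat -> R) : Prop :=
  0 < x 0%nat /\ 0 < x 1%nat /\
  forall n : nat, x (S (S n)) = g (x (S n)) (x n).

Definition is_equilibrium (g : R -> R -> R) (xbar : R) : Prop :=
  0 < xbar /\ xbar = g xbar xbar.

Definition locally_stable (g : R -> R -> R) (xbar : R) : Prop :=
  forall eps : R, 0 < eps ->
  exists delta : R, 0 < delta /\
    forall x : nat -> R, is_solution g x ->
      Rabs (x 0%nat - xbar) + Rabs (x 1%nat - xbar) < delta ->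
      forall n : nat, Rabs (x n - xbar) < eps.

Definition global_attractor (g : R -> R -> R) (xbar : R) : Prop :=
  forall x : nat -> R, is_solution g x -> is_lim_seq x xbar.

Definition globally_asymptotically_stable (g : R -> R -> R) (xbar : R) : Prop :=
  locally_stable g xbar /\ global_attractor g xbar.

(* Main.v *)
(** Writing the equation as [x_{n+1} x_n = p + q / x_{n-1}] and dividing two
    consecutive instances gives
    [x_{n+3} = w x_{n+1} + (1 - w) x_n] with [w = p x_n / (p x_n + q)],
    a convex combination.  Hence an interval containing three consecutive terms
    contains all later ones; in particular the solution stays in a compact
    subset of (0, +oo), on which [w] is bounded away from 0 and 1, and the
    interval then shrinks by a fixed factor every five steps.  Since [fmap] is
    decreasing in both arguments, the equilibrium lies in every such interval. *)
Require Import Defs.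
From Stdlib Require Import Reals Lra Lia.
From Coquelicot Require Import Coquelicot.
Open Scope R_scope.

(** * Sequences that average two earlier terms: invariant windows and contraction *)

Definition averaging (c : R) (x : nat -> R) : Prop :=
  forall n : nat, exists w : R,
    c <= w <= 1 - c /\ x (3 + n)%nat = w * x (1 + n)%nat + (1 - w) * x n.

Definition window (x : nat -> R) (n : nat) (m M : R) : Prop :=
  m <= x n <= M /\ m <= x (1 + n)%nat <= M /\ m <= x (2 + n)%nat <= M.

Lemma averaging_opp (c : R) (x : nat -> R) :
  averaging c x -> averaging c (fun n => - x n).
Proof.
  intros Hx n. destruct (Hx n) as [w [Hw E]].
  exists w. split; [exact Hw|]. rewrite E. ring.
Qed.

Lemma averaging_window (c : R) (x : nat -> R) (n : nat) (m M : R) :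
  0 <= c -> averaging c x -> window x n m M ->
  forall k : nat, window x (k + n) m M.
Proof.
  intros Hc Hx Hn k. induction k as [|k [H0 [H1 H2]]]; [exact Hn|].
  destruct (Hx (k + n)%nat) as [w [Hw E]].
  split; [exact H1|]. split; [exact H2|].
  change (m <= x (3 + (k + n))%nat <= M). rewrite E. split; nra.
Qed.

(** A lead over [m] shrinks by at most the factor [c] whenever it passes through a weight. Index
    [1 + n] feeds [3 + n] and [4 + n], and these feed [5 + n], [6 + n] and [7 + n]: two passages,
    hence [c * c]. *)
Lemma averaging_gain (c : R) (x : nat -> R) (n : nat) (m d : R) :
  0 < c -> averaging c x ->
  m <= x n -> m <= x (1 + n)%nat -> m <= x (2 + n)%nat ->
  0 <= d -> m + d <= x (1 + n)%nat ->
  m + c * c * d <= x (5 + n)%nat /\ m + c * c * d <= x (6 + n)%nat /\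
  m + c * c * d <= x (7 + n)%nat.
Proof.
  intros Hc Hx H0 H1 H2 Hd Hm.
  assert (step : forall (k : nat) (a b : R), 0 <= a -> 0 <= b ->
            m + a <= x (1 + k)%nat -> m + b <= x k ->
            m + c * a <= x (3 + k)%nat /\ m + c * b <= x (3 + k)%nat).
  { intros k a b Ha Hb Hxa Hxb. destruct (Hx k) as [w [Hw ->]].
    assert (c * a <= w * (x (1 + k)%nat - m)) by (apply Rmult_le_compat; lra).
    assert (c * b <= (1 - w) * (x k - m)) by (apply Rmult_le_compat; lra).
    assert (0 <= c * a) by nra. assert (0 <= c * b) by nra. lra. }
  assert (Hcd : 0 <= c * d) by nra.
  destruct (step n d 0) as [H3 _]; [lra ..|].
  destruct (step (1 + n)%nat 0 d) as [_ H4]; [simpl in *; lra ..|].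
  destruct (step (2 + n)%nat (c * d) 0) as [H5 _]; [simpl in *; lra ..|].
  destruct (step (3 + n)%nat (c * d) (c * d)) as [H6 _]; [simpl in *; lra ..|].
  assert (Hccd : 0 <= c * (c * d)) by nra.
  destruct (step (4 + n)%nat 0 (c * d)) as [_ H7]; [simpl in *; lra ..|].
  rewrite Rmult_assoc. simpl in *. auto.
Qed.

Lemma averaging_contract (c : R) (x : nat -> R) (n : nat) (m M : R) :
  0 < c -> averaging c x -> window x n m M ->
  exists m' M' : R,
    window x (5 + n) m' M' /\ M' - m' = (1 - c * c / 2) * (M - m).
Proof.
  intros Hc Hx Hn.
  destruct (averaging_window c x n m M (Rlt_le _ _ Hc) Hx Hn 5)
    as [G0 [G1 G2]].
  destruct Hn as [H0 [H1 H2]].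
  (* The middle term lies in the upper or the lower half of the window, a lead of [(M - m) / 2] over
     one end. The lower half is the upper half for the negated sequence. *)
  destruct (Rle_dec ((m + M) / 2) (x (1 + n)%nat)) as [Hmid|Hmid].
  - destruct (averaging_gain c x n m ((M - m) / 2)) as [K0 [K1 K2]]; try lra;
      [exact Hx|].
    exists (m + c * c * ((M - m) / 2)), M. split; [|field].
    unfold window. simpl in *. repeat split; lra.
  - destruct (averaging_gain c (fun k => - x k) n (- M) ((M - m) / 2))
      as [K0 [K1 K2]]; try lra; [now apply averaging_opp|].
    exists m, (M - c * c * ((M - m) / 2)). split; [|field].
    unfold window. simpl in *. repeat split; lra.
Qed.

Lemma averaging_geometric (c : R) (x : nat -> R) (m M : R) :
  0 < c -> averaging c x -> window x 0 m M ->
  forall k : nat, exists m' M' : R,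
    window x (k * 5) m' M' /\ M' - m' = (1 - c * c / 2) ^ k * (M - m).
Proof.
  intros Hc Hx H0 k. induction k as [|k [m' [M' [Hk E]]]].
  - exists m, M. split; [exact H0|]. simpl. ring.
  - destruct (averaging_contract c x (k * 5) m' M' Hc Hx Hk)
      as [m'' [M'' [Hk' E']]].
    exists m'', M''. split; [exact Hk'|]. rewrite E', E. simpl. ring.
Qed.

(** * Stability and attraction for the difference equation *)

Section Equation.

Variables p q : R.
Hypothesis hp : 0 < p.
Hypothesis hq : 0 < q.

Lemma fmap_pos (x y : R) : 0 < x -> 0 < y -> 0 < fmap p q x y.
Proof.
  intros Hx Hy. unfold fmap. apply Rdiv_lt_0_compat; nra.
Qed.

Lemma fmap_decreasing (x y x' y' : R) :
  0 < x -> 0 < y -> x < x' -> y < y' -> fmap p q x' y' < fmap p q x y.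
Proof.
  intros Hx Hy Hxx Hyy.
  assert (E : forall a b, 0 < a -> 0 < b -> fmap p q a b = (p + q / b) * / a).
  { intros a b Ha Hb. unfold fmap. field. lra. }
  rewrite !E by lra.
  assert (/ x' < / x) by (apply Rinv_lt_contravar; nra).
  assert (/ y' < / y) by (apply Rinv_lt_contravar; nra).
  assert (0 < / x') by (apply Rinv_0_lt_compat; lra).
  assert (0 < / y') by (apply Rinv_0_lt_compat; lra).
  unfold Rdiv. apply Rmult_le_0_lt_compat; nra.
Qed.

Lemma solution_pos (x : nat -> R) :
  is_solution (fmap p q) x -> forall n : nat, 0 < x n.
Proof.
  intros [H0 [H1 Hx]] n.
  enough (0 < x n /\ 0 < x (S n)) by tauto.
  induction n as [|n [IH0 IH1]]; [tauto|].
  split; [exact IH1|]. rewrite Hx. now apply fmap_pos.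
Qed.

(** Inserting the recurrence for [x (2 + n)] into the one for [x (3 + n)] cancels [x (1 + n)] from
    the denominator and leaves [x n * (p * x (1 + n) + q) / (p * x n + q)]. *)
Lemma solution_third_order (x : nat -> R) (n : nat) :
  is_solution (fmap p q) x ->
  x (3 + n)%nat = p * x n / (p * x n + q) * x (1 + n)%nat
                  + (1 - p * x n / (p * x n + q)) * x n.
Proof.
  intros Hx. assert (Hpos := solution_pos x Hx).
  destruct Hx as [_ [_ Hx]].
  assert (P0 := Hpos n). assert (P1 := Hpos (S n)).
  simpl. rewrite (Hx (S n)), (Hx n). unfold fmap. field.
  repeat split; nra.
Qed.

(** The weight increases with [x n], so [m] bounds it from below, while [M] bounds its complement
    [q / (p * x n + q)] from below. *)
Lemma solution_averaging (x : nat -> R) (m M : R) :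
  is_solution (fmap p q) x -> 0 <= m -> (forall n : nat, m <= x n <= M) ->
  averaging (Rmin (p * m / (p * m + q)) (q / (p * M + q))) x.
Proof.
  intros Hx Hm HmM n.
  exists (p * x n / (p * x n + q)).
  split; [|now apply solution_third_order].
  assert (Hn := HmM n).
  assert (L : p * m / (p * m + q) <= p * x n / (p * x n + q)).
  { replace (p * m / (p * m + q)) with (1 - q / (p * m + q)) by (field; nra).
    replace (p * x n / (p * x n + q)) with (1 - q / (p * x n + q))
      by (field; nra).
    apply Rplus_le_compat_l, Ropp_le_contravar, Rmult_le_compat_l; [lra|].
    apply Rinv_le_contravar; nra. }
  assert (U : q / (p * M + q) <= 1 - p * x n / (p * x n + q)).
  { replace (1 - p * x n / (p * x n + q)) with (q / (p * x n + q))
      by (field; nra).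
    unfold Rdiv. apply Rmult_le_compat_l; [lra|].
    apply Rinv_le_contravar; nra. }
  assert (A := Rmin_l (p * m / (p * m + q)) (q / (p * M + q))).
  assert (B := Rmin_r (p * m / (p * m + q)) (q / (p * M + q))).
  lra.
Qed.

(** Weights in [0, 1] already make windows invariant. This yields the bounds on the solution that
    [solution_averaging] takes as input. *)
Lemma solution_averaging_0 (x : nat -> R) :
  is_solution (fmap p q) x -> averaging 0 x.
Proof.
  intros Hx n.
  exists (p * x n / (p * x n + q)).
  split; [|now apply solution_third_order].
  assert (Hn := solution_pos x Hx n).
  replace (p * x n / (p * x n + q)) with (1 - q / (p * x n + q)) by (field; nra).
  assert (0 < q / (p * x n + q)) by (apply Rdiv_lt_0_compat; nra).
  assert (q / (p * x n + q) <= 1) by (apply Rle_div_l; nra).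
  lra.
Qed.

Variable xbar : R.
Hypothesis hxbar : is_equilibrium (fmap p q) xbar.

(** If [xbar < m], then [x n] and [x (1 + n)] both exceed [xbar], so monotonicity pushes [x (2 + n)]
    below [fmap p q xbar xbar = xbar], out of the window. The other side is symmetric. *)
Lemma equilibrium_in_window (x : nat -> R) (n : nat) (m M : R) :
  is_solution (fmap p q) x -> window x n m M -> m <= xbar <= M.
Proof.
  intros Hx [H0 [H1 H2]]. destruct hxbar as [Hpos Heq].
  assert (P0 := solution_pos x Hx n).
  assert (P1 := solution_pos x Hx (1 + n)).
  destruct Hx as [_ [_ Hx]]. simpl in *. rewrite Hx in H2.
  split; apply Rnot_lt_le; intros Hlt.
  - assert (fmap p q (x (S n)) (x n) < fmap p q xbar xbar)
      by (apply fmap_decreasing; lra). lra.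
  - assert (fmap p q xbar xbar < fmap p q (x (S n)) (x n))
      by (apply fmap_decreasing; lra). lra.
Qed.

Lemma equilibrium_global_attractor : global_attractor (fmap p q) xbar.
Proof.
  intros x Hx.
  assert (Hpos := solution_pos x Hx).
  set (m := Rmin (x 0%nat) (Rmin (x 1%nat) (x 2%nat))).
  set (M := Rmax (x 0%nat) (Rmax (x 1%nat) (x 2%nat))).
  assert (Hm : 0 < m) by (repeat apply Rmin_glb_lt; apply Hpos).
  assert (H0 : window x 0 m M).
  { unfold window, m, M. simpl.
    assert (A := Rmin_l (x 0%nat) (Rmin (x 1%nat) (x 2%nat))).
    assert (B := Rmin_r (x 0%nat) (Rmin (x 1%nat) (x 2%nat))).
    assert (A' := Rmin_l (x 1%nat) (x 2%nat)).
    assert (B' := Rmin_r (x 1%nat) (x 2%nat)).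
    assert (D := Rmax_l (x 0%nat) (Rmax (x 1%nat) (x 2%nat))).
    assert (E := Rmax_r (x 0%nat) (Rmax (x 1%nat) (x 2%nat))).
    assert (D' := Rmax_l (x 1%nat) (x 2%nat)).
    assert (E' := Rmax_r (x 1%nat) (x 2%nat)).
    repeat split; lra. }
  assert (Hbd : forall n, m <= x n <= M).
  { intros n.
    destruct (averaging_window 0 x 0 m M (Rle_refl 0)
                (solution_averaging_0 x Hx) H0 n) as [Hn _].
    now rewrite Nat.add_0_r in Hn. }
  assert (HM : 0 < M) by (specialize (Hbd 0%nat); lra).
  assert (Hav := solution_averaging x m M Hx (Rlt_le _ _ Hm) Hbd).
  set (c := Rmin (p * m / (p * m + q)) (q / (p * M + q))) in Hav.
  assert (Hc : 0 < c) by (apply Rmin_glb_lt; apply Rdiv_lt_0_compat; nra).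
  (* Any admissible weight has [c <= w <= 1 - c]. The resulting bound on [c] puts the ratio
     [1 - c * c / 2] strictly between 0 and 1. *)
  assert (Hc1 : c <= 1 / 2) by (destruct (Hav 0%nat) as [w [Hw _]]; lra).
  apply is_lim_seq_spec. intros eps.
  assert (HmM : 0 <= M - m) by (specialize (Hbd 0%nat); lra).
  (* The [+ 1] keeps the denominator positive for a constant solution, where [M = m]. *)
  destruct (pow_lt_1_zero (1 - c * c / 2)) with (y := eps / (M - m + 1))
    as [k Hk].
  { rewrite Rabs_pos_eq; nra. }
  { apply Rdiv_lt_0_compat; [apply cond_pos|lra]. }
  specialize (Hk k (le_n k)).
  assert (Hge : 0 <= (1 - c * c / 2) ^ k) by (apply pow_le; nra).
  rewrite Rabs_pos_eq in Hk by exact Hge.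
  apply Rlt_div_r in Hk; [|lra].
  destruct (averaging_geometric c x m M Hc Hav H0 k) as [m' [M' [Hw E]]].
  assert (Hxb := equilibrium_in_window x (k * 5) m' M' Hx Hw).
  (* From this index on, [x n] and [xbar] share a window shorter than [eps]. *)
  exists (k * 5)%nat. intros n Hn.
  destruct (averaging_window c x (k * 5) m' M' (Rlt_le _ _ Hc) Hav Hw (n - k * 5))
    as [Hxn _].
  replace (n - k * 5 + k * 5)%nat with n in Hxn by lia.
  apply Rabs_def1; nra.
Qed.

(** Continuity of [fmap] brings the third term close to [xbar] too, and the window around the first
    three terms traps the rest. Its radius is [eps / 2] because windows give only non-strict
    bounds. *)
Lemma equilibrium_locally_stable : locally_stable (fmap p q) xbar.
Proof.
  intros eps Heps. destruct hxbar as [Hpos Heq].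
  assert (Hcont : continuity_2d_pt (fmap p q) xbar xbar).
  { unfold fmap, Rdiv. apply continuity_2d_pt_mult.
    - apply continuity_2d_pt_plus; [|apply continuity_2d_pt_const].
      apply continuity_2d_pt_mult;
        [apply continuity_2d_pt_const|apply continuity_2d_pt_id2].
    - apply continuity_2d_pt_inv; [|nra].
      apply continuity_2d_pt_mult;
        [apply continuity_2d_pt_id1|apply continuity_2d_pt_id2]. }
  assert (Heps2 : 0 < eps / 2) by lra.
  destruct (Hcont (mkposreal _ Heps2)) as [d Hd]. simpl in Hd.
  rewrite <- Heq in Hd.
  exists (Rmin d (eps / 2)). split.
  { apply Rmin_glb_lt; [apply cond_pos|exact Heps2]. }
  intros x Hx Hdelta n.
  assert (A := Rmin_l d (eps / 2)). assert (B := Rmin_r d (eps / 2)).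
  assert (A0 := Rabs_pos (x 0%nat - xbar)).
  assert (A1 := Rabs_pos (x 1%nat - xbar)).
  assert (H2 : Rabs (x 2%nat - xbar) < eps / 2).
  { assert (Hx' := Hx). destruct Hx' as [_ [_ E]].
    rewrite E. apply Hd; lra. }
  assert (H0 : Rabs (x 0%nat - xbar) < eps / 2) by lra.
  assert (H1 : Rabs (x 1%nat - xbar) < eps / 2) by lra.
  apply Rabs_def2 in H0. apply Rabs_def2 in H1. apply Rabs_def2 in H2.
  destruct (averaging_window 0 x 0 (xbar - eps / 2) (xbar + eps / 2)
              (Rle_refl 0) (solution_averaging_0 x Hx)) with (k := n)
    as [Hn _].
  { unfold window. simpl. repeat split; lra. }
  rewrite Nat.add_0_r in Hn. apply Rabs_def1; lra.
Qed.

End Equation.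

(** * Equilibria as positive roots of a cubic *)

Lemma equilibrium_cubic (p q x : R) :
  0 < x -> (is_equilibrium (fmap p q) x <-> x ^ 3 = p * x + q).
Proof.
  intros Hx. unfold is_equilibrium, fmap. split.
  - intros [_ H]. apply (f_equal (fun t => t * (x * x))) in H.
    transitivity (x * (x * x)); [ring|]. rewrite H. field. lra.
  - intros H. split; [exact Hx|]. rewrite <- H. field. lra.
Qed.

(** Since [x * (x * x - p) = q > 0], the quadratic factor left after dividing the difference of the
    two cubics by [y - x] is positive. *)
Lemma equilibrium_unique (p q x y : R) :
  0 < q -> is_equilibrium (fmap p q) x -> is_equilibrium (fmap p q) y -> x = y.
Proof.
  intros hq Hx Hy.
  assert (Px := proj1 Hx). assert (Py := proj1 Hy).
  apply equilibrium_cubic in Hx; [|exact Px].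
  apply equilibrium_cubic in Hy; [|exact Py].
  assert (Hxp : p < x * x) by nra.
  assert (E : (y - x) * (y * y + x * y + x * x - p) = 0) by nra.
  apply Rmult_integral in E. destruct E; nra.
Qed.

(** * Principal roots and Cardano's formula *)

Lemma Croot_pos (n : nat) (a : R) :
  0 < a -> Croot n (RtoC a) = RtoC (Rpower a (/ INR n)).
Proof.
  intros Ha. unfold Croot, Carg. rewrite Cmod_R, Rabs_pos_eq by lra.
  destruct (Req_dec_T a 0) as [E|_]; [lra|]. simpl.
  destruct (Rle_dec 0 0) as [_|E]; [|lra].
  replace (a / a) with 1 by (field; lra). rewrite acos_1.
  unfold Rdiv. rewrite Rmult_0_l, cos_0, sin_0.
  unfold Cmult, RtoC; simpl. f_equal; ring.
Qed.

Lemma Rpower_inv_pow (n : nat) (a : R) :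
  0 < a -> n <> 0%nat -> Rpower a (/ INR n) ^ n = a.
Proof.
  intros Ha Hn. rewrite <- Rpower_pow by apply exp_pos.
  rewrite Rpower_mult, Rinv_l by now apply not_0_INR.
  now apply Rpower_1.
Qed.

Lemma Csqrt_nonneg (a : R) :
  0 <= a -> exists s : R, 0 <= s /\ s ^ 2 = a /\ Croot 2 (RtoC a) = RtoC s.
Proof.
  intros [Ha|<-].
  - exists (Rpower a (/ INR 2)). split; [left; apply exp_pos|].
    split; [now apply Rpower_inv_pow|now apply Croot_pos].
  (* In [phi] this case arises when [27 * q ^ 2 = 4 * p ^ 3]. *)
  - exists 0. split; [lra|]. split; [ring|].
    unfold Croot. rewrite Cmod_0. destruct (Req_dec_T 0 0); [easy|lra].
Qed.

(** The principal argument of a negative real is [PI]; halving it gives the positive imaginary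
    axis. *)
Lemma Csqrt_neg (a : R) :
  a < 0 -> exists s : R, 0 < s /\ s ^ 2 = - a /\ Croot 2 (RtoC a) = (0, s).
Proof.
  intros Ha. exists (Rpower (- a) (/ INR 2)). split; [apply exp_pos|].
  split; [apply Rpower_inv_pow; [lra|easy]|].
  unfold Croot, Carg. rewrite Cmod_R, Rabs_left by lra.
  destruct (Req_dec_T (- a) 0) as [E|_]; [lra|]. simpl Im. simpl Re.
  destruct (Rle_dec 0 0) as [_|E]; [|lra].
  replace (a / - a) with (- (1)) by (field; lra).
  rewrite acos_opp, acos_1, Rminus_0_r.
  replace (PI / INR 2) with (PI / 2) by (simpl; field).
  rewrite cos_PI2, sin_PI2.
  unfold Cmult, RtoC; simpl. f_equal; ring.
Qed.

Lemma cos_triple (t : R) : cos (3 * t) = 4 * cos t ^ 3 - 3 * cos t.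
Proof.
  replace (3 * t) with (2 * t + t) by ring.
  rewrite cos_plus, cos_2a_cos, sin_2a.
  assert (H := sin2_cos2 t). unfold Rsqr in H.
  replace (2 * sin t * cos t * sin t) with (2 * cos t * (sin t * sin t)) by ring.
  replace (sin t * sin t) with (1 - cos t * cos t) by lra. ring.
Qed.

Lemma phi_equilibrium (p q : R) :
  0 < p -> 0 < q ->
  exists xbar : R, phi p q = RtoC xbar /\ is_equilibrium (fmap p q) xbar.
Proof.
  intros hp hq. unfold phi.
  destruct (Rle_lt_dec 0 (- 12 * p ^ 3 + 81 * q ^ 2)) as [HD|HD].
  - destruct (Csqrt_nonneg _ HD) as [s [Hs [Hs2 ->]]].
    rewrite <- RtoC_mult, <- RtoC_plus.
    assert (Ha : 0 < 108 * q + 12 * s) by lra.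
    rewrite Croot_pos by exact Ha.
    assert (Hr3 := Rpower_inv_pow 3 _ Ha (Nat.neq_succ_0 2)).
    assert (Hr : 0 < Rpower (108 * q + 12 * s) (/ INR 3)) by apply exp_pos.
    set (r := Rpower (108 * q + 12 * s) (/ INR 3)) in *.
    exists ((r * r + 12 * p) / (6 * r)). split.
    { rewrite <- !RtoC_mult, <- RtoC_plus, <- RtoC_div; [easy|lra]. }
    assert (Hx : 0 < (r * r + 12 * p) / (6 * r))
      by (apply Rdiv_lt_0_compat; nra).
    apply equilibrium_cubic; [exact Hx|].
    (* The resolvent quadratic in [r ^ 3], obtained by squaring [r ^ 3 - 108 * q = 12 * s]. Its left
       side is the numerator of the cubic over [216 * r ^ 3]. *)
    assert (E : r ^ 6 - 216 * q * r ^ 3 + 1728 * p ^ 3 = 0).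
    { replace (r ^ 6) with (r ^ 3 * r ^ 3) by ring. rewrite Hr3. nra. }
    apply Rminus_diag_uniq.
    replace (((r * r + 12 * p) / (6 * r)) ^ 3
             - (p * ((r * r + 12 * p) / (6 * r)) + q))
      with ((r ^ 6 - 216 * q * r ^ 3 + 1728 * p ^ 3) / (216 * r ^ 3))
      by (field; lra).
    rewrite E. unfold Rdiv. ring.
  - (* Casus irreducibilis: the cube root [r] has [|r|^2 = 12 p], so the
       fraction is [(r + conj r) / 6], and the cubic is the formula for
       [cos (3 t)]. *)
    destruct (Csqrt_neg _ HD) as [s [Hs [Hs2 ->]]].
    replace (RtoC (108 * q) + RtoC 12 * (0, s))%C with ((108 * q, 12 * s) : C)
      by (unfold Cmult, Cplus, RtoC; simpl; f_equal; ring).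
    unfold Croot, Carg.
    (* The terms in [q] cancel, as [s ^ 2 = 12 * p ^ 3 - 81 * q ^ 2]. *)
    assert (HZ2 : Cmod (108 * q, 12 * s) ^ 2 = 1728 * p ^ 3).
    { unfold Cmod; simpl fst; simpl snd. rewrite pow2_sqrt by nra. nra. }
    assert (HZ : 0 < Cmod (108 * q, 12 * s)).
    { apply Cmod_gt_0. intros E. injection E. lra. }
    set (Z := Cmod (108 * q, 12 * s)) in *.
    destruct (Req_dec_T Z 0) as [E|_]; [lra|]. simpl Im. simpl Re.
    destruct (Rle_dec 0 (12 * s)) as [_|E]; [|lra].
    assert (Hr3 := Rpower_inv_pow 3 _ HZ (Nat.neq_succ_0 2)).
    assert (Hr : 0 < Rpower Z (/ INR 3)) by apply exp_pos.
    set (rho := Rpower Z (/ INR 3)) in *.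
    assert (Hr2 : rho ^ 2 = 12 * p).
    { assert (E : (rho ^ 2) ^ 3 = (12 * p) ^ 3)
        by (replace ((rho ^ 2) ^ 3) with ((rho ^ 3) ^ 2) by ring;
            rewrite Hr3, HZ2; ring).
      assert (0 < rho ^ 2) by nra.
      set (a := rho ^ 2) in *.
      assert (F : (a - 12 * p) * (a * a + a * (12 * p) + 12 * p * (12 * p)) = 0)
        by nra.
      apply Rmult_integral in F. destruct F; nra. }
    assert (Hcos : -1 <= 108 * q / Z <= 1).
    { split.
      - assert (0 < 108 * q / Z) by (apply Rdiv_lt_0_compat; lra). lra.
      - apply Rle_div_l; [exact HZ|].
        assert (H12 : (108 * q) ^ 2 <= Z ^ 2) by nra. nra. }
    assert (Hb := acos_bound (108 * q / Z)).
    assert (Hct := cos_triple (acos (108 * q / Z) / INR 3)).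
    replace (3 * (acos (108 * q / Z) / INR 3)) with (acos (108 * q / Z)) in Hct
      by (simpl; field).
    rewrite cos_acos in Hct by exact Hcos.
    (* The principal argument lies in [0, PI], so its third is at most [PI / 3]: the principal
       branch selects the positive root. *)
    assert (Hpos : 0 < cos (acos (108 * q / Z) / INR 3)).
    { assert (HPI := PI_RGT_0).
      apply cos_gt_0; simpl; lra. }
    assert (Hsc := sin2_cos2 (acos (108 * q / Z) / INR 3)).
    unfold Rsqr in Hsc.
    set (t := acos (108 * q / Z) / INR 3) in *.
    exists (rho * cos t / 3). split.
    + set (r := (RtoC rho * (cos t, sin t))%C).
      assert (Hr0 : r <> 0%C).
      { unfold r, Cmult, RtoC. simpl. intros E. injection E. nra. }
      assert (E : (r * r + RtoC (12 * p))%C = (RtoC (2 * (rho * cos t)) * r)%C).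
      { rewrite <- Hr2.
        replace (rho ^ 2) with (rho ^ 2 * (sin t * sin t + cos t * cos t))
          by (rewrite Hsc; ring).
        unfold r, Cmult, Cplus, RtoC; simpl. f_equal; ring. }
      rewrite E.
      replace (rho * cos t / 3) with (2 * (rho * cos t) / 6) by field.
      rewrite RtoC_div by lra. field. exact Hr0.
    + apply equilibrium_cubic; [nra|].
      (* This compares real parts in the cube of [r]. With [p] and [q] both expressed through [rho]
         and [cos t], the cubic becomes an identity. *)
      assert (HZr : 108 * q = rho ^ 3 * (4 * cos t ^ 3 - 3 * cos t)).
      { rewrite <- Hct, Hr3. field. lra. }
      replace q with (108 * q / 108) by field. rewrite HZr.
      replace p with (12 * p / 12) by field. rewrite <- Hr2. field.
Qed.

Theorem theorem4 (p q : R) (hp : 0 < p) (hq : 0 < q) :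
  exists xbar : R,
    phi p q = RtoC xbar /\
    unique (is_equilibrium (fmap p q)) xbar /\
    globally_asymptotically_stable (fmap p q) xbar.
Proof.
  destruct (phi_equilibrium p q hp hq) as [xbar [Hphi Heq]].
  exists xbar. split; [exact Hphi|]. split.
  - split; [exact Heq|]. intros y Hy. now apply (equilibrium_unique p q).
  - split; [now apply equilibrium_locally_stable|].
    now apply equilibrium_global_attractor.
Qed.
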